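(* Let $r\ge n>1$ be integers such that the matrix $H_S$ is singular. Then no block $\begin{pmatrix}0&4\\-4&0\end{pmatrix}$ appears in the block diagonal form of $H_S$.
   Context: $N_r$ is the $r\times r$ matrix with all entries on and above the diagonal equal to $-1$ and zeros below the diagonal; $M_r=-N_r^t$. $H_S$ is the $nr\times nr$ integer skew-symmetric matrix consisting of $n\times n$ blocks of size $r\times r$ with diagonal blocks $-(M_r+N_r)$, all blocks above the diagonal equal to the identity $\mathbb I$ and all blocks below the diagonal equal to $-\mathbb I$. A block diagonal form of a skew-symmetric integer matrix $J$ of size $N$ and corank $c$ is a matrix $L^tJL=\operatorname{Diag}(D_1,\dots,D_k,0,\dots,0)$, with $L$ an integer matrix of determinant $\pm1$, $k=\tfrac12(N-c)$, and $D_i=\begin{pmatrix}0&h_i\\-h_i&0\end{pmatrix}$ nonzero; blocks are counted up to the sign of $h_i$. For $H_S$ all $|h_i|$ are in $\{1,2,4\}$ and their multiplicities are independent of the choice of $L$. *)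

(* Defs.v *)
From mathcomp Require Import all_boot all_order all_algebra.

Set Implicit Arguments.
Unset Strict Implicit.
Unset Printing Implicit Defensive.

Import Order.TTheory GRing.Theory Num.Theory.
Local Open Scope ring_scope.

Definition N_mx (r : nat) : 'M[int]_r :=
  \matrix_(i < r, j < r) (if (i <= j)%N then -1 else 0).

Definition M_mx (r : nat) : 'M[int]_r := - (N_mx r)^T.

Definition HS_block (n r : nat) (i j : 'I_n) : 'M[int]_r :=
  if i == j then - (M_mx r + N_mx r)
  else if (i < j)%N then 1%:M else - 1%:M.

(* The size n * r is written \sum_(i < n) r, as required by \mxblock. *)
Definition HS (n r : nat) : 'M[int]_(\sum_(i < n) r) :=
  \mxblock_(i < n, j < n) HS_block r i j.

Definition corank (N : nat) (J : 'M[int]_N) : nat :=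
  (N - \rank (map_mx intr J : 'M[rat]_N))%N.

(* Diag(D_1, ..., D_k, 0, ..., 0) of size N, for h = [:: h_1; ...; h_k] and
   D_m the 2 x 2 matrix with rows (0, h_m) and (- h_m, 0).  With indices
   starting at 0, the block of h`_m occupies rows and columns 2m and 2m + 1.
   Since h`_m = 0 for m >= size h, the rest of the matrix is zero; the
   intended use has 2 * size h <= N. *)
Definition skew_diag (N : nat) (h : seq int) : 'M[int]_N :=
  \matrix_(i < N, j < N)
    (if ~~ odd i && (j == i.+1 :> nat) then h`_(i./2)
     else if ~~ odd j && (i == j.+1 :> nat) then - h`_(j./2)
     else 0).

Definition block_diagonal_form (N : nat) (J L : 'M[int]_N) (h : seq int) : Prop :=
  [/\ \det L = 1 \/ \det L = -1,
      size h = (N - corank J)./2,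
      {in h, forall x, x != 0}
    & L^T *m J *m L = skew_diag N h].

(* Main.v *)
(** Idea: a vector of size n r is a function V on pairs of naturals with
    V (a + n, b) = V (a, b + r) = - V (a, b), i.e. an element of
    R = Z[x,y]/(x^n + 1, y^r + 1), and H_S acts as multiplication by
    t = (x + ... + x^(n-1)) + (y + ... + y^(r-1)), which satisfies
    (1 - x)(1 - y) t = 2 (1 - xy).  As R/(1 - xy) = Z[x]/(x^n + 1, x^r + 1),
    H_S is singular iff n/g and r/g are odd with g = gcd(n, r), and then
    R/(1 - xy) = Z[x]/(x^g + 1) is torsion-free.  If t v = 4 w, then
    (1 - xy) v = 2 (1 - x)(1 - y) w, so v is modulo 2 an element of the kernel
    of 1 - xy, and hence by torsion-freeness the reduction of an exact element
    z of this kernel; thus t z = 0 and t ((v - z)/2) = 2 w.  So the cokernel of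
    H_S has no element of order 4, whereas a block with h = 4 would give one. *)

Require Import Defs.
From mathcomp Require Import all_boot all_order all_algebra.
From mathcomp Require Import zify.

Set Implicit Arguments.
Unset Strict Implicit.
Unset Printing Implicit Defensive.

Import Order.TTheory GRing.Theory Num.Theory.
Local Open Scope ring_scope.

Lemma mulmxMn (R : pzSemiRingType) m n p (A : 'M[R]_(m, n)) (B : 'M_(n, p)) k :
  A *m (B *+ k) = (A *m B) *+ k.
Proof. exact: raddfMn. Qed.

(** * Antiperiodic functions and shift sums *)

Definition antiperiodic (n : nat) (f : nat -> int) : Prop :=
  forall a, f (a + n)%N = - f a.

Definition biantiperiodic (n r : nat) (V : nat -> nat -> int) : Prop :=
  (forall b, antiperiodic n (V^~ b)) /\ (forall a, antiperiodic r (V a)).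

Definition shift_sum (n : nat) (f : nat -> int) (a : nat) : int :=
  \sum_(1 <= k < n) f (a + k)%N.

Definition HS_fun (n r : nat) (V : nat -> nat -> int) (a b : nat) : int :=
  shift_sum n (V^~ b) a + shift_sum r (V a) b.

Definition HS_vec (n r : nat) (V : nat -> nat -> int) :
    'cV[int]_(\sum_(i < n) r) :=
  \mxcol_(i < n) \col_(j < r) V i j.

Definition antiext (n : nat) (f : nat -> int) (a : nat) : int :=
  (-1) ^+ (a %/ n) * f (a %% n)%N.

Lemma antiperiodicMn n f k a :
  antiperiodic n f -> f (a + k * n)%N = (-1) ^+ k * f a.
Proof.
move=> fP; elim: k => [|k IHk]; first by rewrite mul0n addn0 mul1r.
by rewrite mulSn addnCA addnC fP IHk exprS mulN1r mulNr.
Qed.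

Lemma antiext_id n f : antiperiodic n f -> antiext n f =1 f.
Proof.
by move=> fP a; rewrite /antiext -(antiperiodicMn _ _ fP) addnC -divn_eq.
Qed.

Lemma antiext_antiperiodic n f : (0 < n)%N -> antiperiodic n (antiext n f).
Proof.
by move=> n_gt0 a; rewrite /antiext modnDr divnDr // divnn n_gt0 addn1
  exprS mulN1r mulNr.
Qed.

Lemma antiext_small n f a : (a < n)%N -> antiext n f a = f a.
Proof. by move=> ltan; rewrite /antiext divn_small // modn_small // mul1r. Qed.

Lemma antiperiodic_const n f :
  antiperiodic n f -> (forall a, f a.+1 = f a) -> forall a, f a = 0.
Proof.
move=> fP fS a; have fD k : f (a + k)%N = f a.
  by elim: k => [|k IHk]; rewrite ?addn0 // addnS fS.
by have := fP a; rewrite fD; lia.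
Qed.

Lemma shift_sum_antiperiodic n m f :
  antiperiodic n f -> antiperiodic n (shift_sum m f).
Proof.
move=> fP a; rewrite /shift_sum -sumrN; apply: eq_bigr => k _.
by rewrite addnAC fP.
Qed.

(** The sum telescopes: (1 - x)(x + ... + x^(n-1)) = x - x^n, and x^n = -1. *)
Lemma shift_sum_diff n f a : (0 < n)%N -> antiperiodic n f ->
  shift_sum n f a - shift_sum n f a.+1 = f a + f a.+1.
Proof.
move=> n_gt0 fP; rewrite /shift_sum -sumrB.
rewrite (telescope_sumr_eq (fun k => - f (a + k)%N)) //.
  by rewrite fP addn1 !opprK.
by move=> k _; rewrite addnS addSn opprK addrC.
Qed.

(** * The operator [HS_fun] and its kernel *)

Lemma HS_fun_biantiperiodic n r V :
  biantiperiodic n r V -> biantiperiodic n r (HS_fun n r V).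
Proof.
case=> Vn Vr; split=> [b a|a b]; rewrite /HS_fun opprD; congr (_ + _).
- exact: shift_sum_antiperiodic.
- by rewrite -sumrN; apply: eq_bigr => k _; exact: Vn.
- by rewrite -sumrN; apply: eq_bigr => k _; exact: Vr.
- exact: shift_sum_antiperiodic.
Qed.

(** By [shift_sum_diff] in each variable, (1 - x)(1 - y) t = (1 - y)(1 + x) + (1 - x)(1 + y), in
    which the mixed terms cancel. *)
Lemma HS_fun_diff n r V a b : (0 < n)%N -> (0 < r)%N -> biantiperiodic n r V ->
  let W := HS_fun n r V in
  W a b - W a.+1 b - (W a b.+1 - W a.+1 b.+1) = (V a b - V a.+1 b.+1) *+ 2.
Proof.
move=> n_gt0 r_gt0 [Vn Vr] /=; rewrite /HS_fun.
have := shift_sum_diff a n_gt0 (Vn b).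
have := shift_sum_diff a n_gt0 (Vn b.+1).
have := shift_sum_diff b r_gt0 (Vr a).
have := shift_sum_diff b r_gt0 (Vr a.+1).
lia.
Qed.

(** By [HS_fun_diff], (1 - x)(1 - y) kills [HS_fun n r V]. Both factors cancel, since a
    shift-invariant antiperiodic function vanishes. *)
Lemma HS_fun_eq0 n r V : (0 < n)%N -> (0 < r)%N -> biantiperiodic n r V ->
  (forall a b, V a.+1 b.+1 = V a b) -> forall a b, HS_fun n r V a b = 0.
Proof.
move=> n_gt0 r_gt0 VP VS.
have [Wn Wr] := HS_fun_biantiperiodic VP.
have dW := fun a b => HS_fun_diff a b n_gt0 r_gt0 VP.
move: (HS_fun n r V) Wn Wr dW => W Wn Wr /= dW.
have {}dW a b : W a b - W a.+1 b = 0.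
  apply: (@antiperiodic_const r (fun b => W a b - W a.+1 b)) b.
    by move=> b' /=; rewrite !Wr opprD.
  by move=> b' /=; have /= := dW a b'; rewrite VS; lia.
move=> a b; apply: (antiperiodic_const (Wn b)) => {}a.
by have := dW a b; lia.
Qed.

Lemma HS_fun_ker n r V : (0 < n)%N -> (0 < r)%N -> biantiperiodic n r V ->
  (forall a b, HS_fun n r V a b = 0) -> forall a b, V a.+1 b.+1 = V a b.
Proof.
move=> n_gt0 r_gt0 VP V0 a b.
by have /= := HS_fun_diff a b n_gt0 r_gt0 VP; rewrite !V0; lia.
Qed.

(** With g = gcd(n, r), a diagonal move by lcm(n, r) fixes [V a b] but also multiplies it by
    (-1)^(r/g + n/g). Hence n/g and r/g have the same parity, and being coprime they are not both
    even. *)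
Lemma odd_of_diag n r V a b : (0 < n)%N -> biantiperiodic n r V ->
  (forall a b, V a.+1 b.+1 = V a b) -> V a b != 0 ->
  odd (n %/ gcdn n r) && odd (r %/ gcdn n r).
Proof.
move=> n_gt0 [Vn Vr] VS nzV.
have g_gt0 : (0 < gcdn n r)%N by rewrite gcdn_gt0 n_gt0.
have VD k : V (a + k)%N (b + k)%N = V a b.
  by elim: k => [|k IHk]; rewrite ?addn0 // !addnS VS.
have co : coprime (n %/ gcdn n r) (r %/ gcdn n r).
  rewrite /coprime -(eqn_pmul2r g_gt0) muln_gcdl !divnK ?dvdn_gcdl ?dvdn_gcdr //.
  by rewrite mul1n.
have eq_lcm : (r %/ gcdn n r * n = n %/ gcdn n r * r)%N.
  by rewrite -[X in (_ * X)%N = _](divnK (dvdn_gcdl n r)) mulnCA mulnA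
    -mulnA divnK ?dvdn_gcdr.
have := VD (r %/ gcdn n r * n)%N.
rewrite (antiperiodicMn _ _ (Vn _)) eq_lcm (antiperiodicMn _ _ (Vr _)).
rewrite mulrA -exprD -signr_odd oddD.
case: (boolP (odd (n %/ _))); case: (boolP (odd (r %/ _))) => //=; try lia.
rewrite -!dvdn2 => dr dn _.
by have := dvdn_gcd 2 (n %/ gcdn n r) (r %/ gcdn n r); rewrite dn dr (eqP co).
Qed.

(* [V] modulo 2 depends only on [a - b] modulo [g = gcdn n r]; since [n / g] and
   [r / g] are odd, it lifts to the exact solution [phi (a - b)] with [phi] the
   [g]-antiperiodic extension of [V _ 0].  To stay in [nat], [a - b] is replaced
   by [a + c * b] with [c = 2 n r - 1]. *)
Lemma lift_mod2 n r V : (0 < n)%N -> (0 < r)%N -> biantiperiodic n r V ->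
  odd (n %/ gcdn n r) && odd (r %/ gcdn n r) ->
  (forall a b, (2 %| V a b - V a.+1 b.+1)%Z) ->
  exists W, [/\ biantiperiodic n r W, forall a b, W a.+1 b.+1 = W a b
              & forall a b, (2 %| V a b - W a b)%Z].
Proof.
move=> n_gt0 r_gt0 [Vn Vr] /andP[odd_n odd_r] VS.
set g := gcdn n r in odd_n odd_r *.
have g_gt0 : (0 < g)%N by rewrite gcdn_gt0 n_gt0.
have def_n : n = (n %/ g * g)%N by rewrite divnK ?dvdn_gcdl.
have def_r : r = (r %/ g * g)%N by rewrite divnK ?dvdn_gcdr.
pose e a b := (2 %| V a b)%Z.
have eS k a b : e (a + k)%N (b + k)%N = e a b.
  elim: k => [|k <-]; first by rewrite !addn0.
  by rewrite !addnS /e; have := VS (a + k)%N (b + k)%N; lia.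
have en k a b : e (a + k * n)%N b = e a b.
  by rewrite /e (antiperiodicMn _ _ (Vn _)) !dvdzE abszMsign.
have er k a b : e a (b + k * r)%N = e a b.
  by rewrite /e (antiperiodicMn _ _ (Vr _)) !dvdzE abszMsign.
have eg k a b : e (a + k * g)%N b = e a b.
  elim: k a => [|k IHk] a; first by rewrite mul0n addn0.
  (* Bezout: u n = v r + g, so a shift of [a] by g is one by u n followed by one by - v r, and the
     latter is traded along the diagonal for a shift of [b]. *)
  rewrite mulSn addnA IHk /g; have [u v uv _] := egcdnP r n_gt0.
  rewrite -(eS (v * r)%N) er -addnA [(gcdn _ _ + _)%N]addnC -uv.
  by rewrite en.
pose phi := antiext g (V^~ 0%N).
have phiP : antiperiodic g phi by exact: antiext_antiperiodic.
(* As c + 1 is an even multiple of g, a diagonal step preserves [phi (a + c * b)]. As c is odd,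
   adding r to [b] flips its sign. *)
pose c := (2 * n * r).-1.
have defc : (c.+1 = 2 * (n %/ g) * r * g)%N by rewrite /c; nia.
have odd_c : odd c.
  by have := congr1 odd defc; rewrite -!mulnA oddM /= => /negbFE.
exists (fun a b => phi (a + c * b)%N); split.
- split=> [b a|a b].
    rewrite addnAC [in LHS]def_n (antiperiodicMn _ _ phiP).
    by rewrite -signr_odd odd_n mulN1r.
  rewrite mulnDr addnA [in LHS]def_r mulnA (antiperiodicMn _ _ phiP).
  by rewrite -signr_odd oddM odd_r odd_c mulN1r.
- move=> a b.
  have -> : (a.+1 + c * b.+1)%N = (a + c * b + c.+1)%N by rewrite mulnS; lia.
  rewrite defc (antiperiodicMn _ _ phiP).
  by rewrite -signr_odd -mulnA oddM /= mul1r.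
move=> a b.
suff: e a b = (2 %| phi (a + c * b)%N)%Z by rewrite /e; lia.
(* The points (a, b) and (a + c b, 0) have the same difference of coordinates modulo g. *)
transitivity (e (a + c * b)%N 0%N).
  rewrite -(eS b _ 0%N) add0n -addnA -mulSnr defc.
  by rewrite [in RHS]mulnAC eg.
rewrite /phi /antiext {1}[(a + _)%N](divn_eq _ g) addnC eg.
by rewrite /e !dvdzE abszMsign.
Qed.

(** * Vectors as biantiperiodic functions, and the action of [HS n r] on them *)

Lemma HS_vecE n r V (i : 'I_n) (j : 'I_r) :
  submxcol (HS_vec n r V) i j 0 = V i j.
Proof. by rewrite mxcolK mxE. Qed.

Lemma block_colP n r (u v : 'cV[int]_(\sum_(i < n) r)) :
  (forall i j, submxcol u i j 0 = submxcol v i j 0) -> u = v.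
Proof.
by move=> uv; apply/mxcolP => i; apply/colP => j; rewrite uv.
Qed.

Lemma HS_vec_inj n r V W : biantiperiodic n r V -> biantiperiodic n r W ->
  (0 < n)%N -> (0 < r)%N ->
  HS_vec n r V = HS_vec n r W -> forall a b, V a b = W a b.
Proof.
move=> [Vn Vr] [Wn Wr] n_gt0 r_gt0 VW a b.
rewrite -(antiext_id (Vn b)) -(antiext_id (Wn b)) /antiext.
rewrite -(antiext_id (Vr _)) -(antiext_id (Wr _)) /antiext.
have ltan : (a %% n < n)%N by rewrite ltn_mod.
have ltbr : (b %% r < r)%N by rewrite ltn_mod.
have := HS_vecE V (Ordinal ltan) (Ordinal ltbr).
by rewrite VW HS_vecE /= => ->.
Qed.

Lemma HS_vec_surj n r (v : 'cV[int]_(\sum_(i < n) r)) :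
  (0 < n)%N -> (0 < r)%N ->
  exists2 V, biantiperiodic n r V & HS_vec n r V = v.
Proof.
case: n r v => // n [] // r v _ _.
pose f a b := submxcol v (inord a) (inord b) 0.
exists (fun a b => antiext n.+1 (fun a => antiext r.+1 (f a) b) a).
  split=> [b a|a b]; first by rewrite antiext_antiperiodic.
  by rewrite /antiext -mulrN -(antiext_antiperiodic _ (ltn0Sn r)).
apply: block_colP => i j; rewrite HS_vecE.
by rewrite !antiext_small // /f !inord_val.
Qed.

(** The terms with j < i carry the sign -1, which antiperiodicity absorbs as - f j = f (j + n). The
    indices then run from i + 1 to i + n - 1. *)
Lemma sum_sgn_antiperiodic n f (i : 'I_n) : antiperiodic n f ->
  \sum_(j < n) ((i < j)%N%:Z - (j < i)%N%:Z) * f j = shift_sum n f i.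
Proof.
move=> fP.
rewrite -(big_mkord xpredT (fun j => ((i < j)%N%:Z - (j < i)%N%:Z) * f j)).
rewrite (big_cat_nat (n := i)) //=; last exact: ltnW.
rewrite [X in _ + X]big_ltn // ltnn subrr mul0r add0r addrC.
rewrite /shift_sum [RHS](big_cat_nat (n := (n - i)%N)) ?leq_subr ?subn_gt0 //=.
congr (_ + _).
  rewrite -{1}[i.+1]add1n big_addn; apply: eq_big_nat => k /andP[k_gt0 _].
  have -> : (i < k + i)%N by lia.
  have -> : (k + i < i)%N = false by lia.
  by rewrite mul1r addnC.
rewrite -[(n - i)%N in RHS]add0n big_addn subKn; last exact: ltnW.
apply: eq_big_nat => k /= ltki.
have -> : (i < k)%N = false by lia.
rewrite ltki sub0r mulN1r -fP; congr f.
by have := ltn_ord i; lia.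
Qed.

(** This exhibits [HS n r] as the Kronecker sum of two sign matrices, of sizes n and r, each of
    which acts as a shift sum in one variable. *)
Lemma HS_blockE n r (i j : 'I_n) (k l : 'I_r) :
  HS_block r i j k l = ((k < l)%N%:Z - (l < k)%N%:Z) * (j == i)%:R
                       + ((i < j)%N%:Z - (j < i)%N%:Z) * (l == k)%:R.
Proof.
rewrite /HS_block eq_sym; case: eqVneq => [->|neq_ji].
  rewrite !mxE ltnn subrr mul0r addr0 mulr1.
  by case: ltngtP => _; lia.
rewrite mulr0 add0r.
have: (j != i :> nat) by [].
case: (ltngtP i j) => //= _ _; rewrite !mxE eq_sym; case: eqP => _; lia.
Qed.

Lemma HS_mul_vec n r V : biantiperiodic n r V ->
  HS n r *m HS_vec n r V = HS_vec n r (HS_fun n r V).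
Proof.
move=> [Vn Vr]; rewrite /HS /HS_vec mul_mxblock_mxrow.
apply/eq_mxcolP => i; apply/colP => k; rewrite summxE mxE /HS_fun.
rewrite -(sum_sgn_antiperiodic _ (Vn k)) -(sum_sgn_antiperiodic _ (Vr i)).
rewrite addrC (bigD1 i) //= [X in _ = _ + X](bigD1 i) //= ltnn subrr mul0r add0r.
congr (_ + _).
  rewrite mxE; apply: eq_bigr => l _; rewrite HS_blockE mxE eqxx ltnn.
  by rewrite subrr mul0r addr0 mulr1.
apply: eq_bigr => j neq_ji; rewrite mxE (bigD1 k) //= big1 => [|l neq_lk].
  by rewrite HS_blockE mxE (negPf neq_ji) eqxx mulr0 add0r mulr1 addr0.
by rewrite HS_blockE (negPf neq_ji) (negPf neq_lk) !mulr0 addr0 mul0r.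
Qed.

(** * Consequences of singularity *)

Lemma HS_singular_odd n r : (0 < n)%N -> (0 < r)%N -> \det (HS n r) = 0 ->
  odd (n %/ gcdn n r) && odd (r %/ gcdn n r).
Proof.
move=> n_gt0 r_gt0; rewrite -det_tr => /eqP/det0P[v nzv vH].
have [V VP defv] := HS_vec_surj v^T n_gt0 r_gt0.
have V0 a b : HS_fun n r V a b = 0.
  apply: (@HS_vec_inj n r _ (fun _ _ => 0)) a b => //.
    exact: HS_fun_biantiperiodic.
  rewrite -HS_mul_vec // defv -[HS n r]trmxK -trmx_mul vH trmx0.
  by apply: block_colP => i j; rewrite HS_vecE !mxE.
have VS := HS_fun_ker n_gt0 r_gt0 VP V0.
have [/existsP[i /existsP[j nzV]] | /existsPn V00] :=
  boolP [exists i : 'I_n, [exists j : 'I_r, V i j != 0]].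
  exact: odd_of_diag nzV.
case/eqP: nzv; apply: trmx_inj; rewrite -defv trmx0.
apply: block_colP => i j; rewrite HS_vecE !mxE.
by have /existsPn/(_ j)/negPn/eqP := V00 i.
Qed.

Lemma HS_singular_halve n r (v w : 'cV[int]_(\sum_(i < n) r)) :
  (0 < n)%N -> (0 < r)%N -> \det (HS n r) = 0 ->
  HS n r *m v = w *+ 4 -> exists u, HS n r *m u = w *+ 2.
Proof.
move=> n_gt0 r_gt0 detH Hv.
have oddnr := HS_singular_odd n_gt0 r_gt0 detH.
have [V VP defv] := HS_vec_surj v n_gt0 r_gt0.
have [W WP defw] := HS_vec_surj w n_gt0 r_gt0.
have HV a b : HS_fun n r V a b = W a b *+ 4.
  apply: (@HS_vec_inj n r _ (fun a b => W a b *+ 4)) a b => //.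
  - exact: HS_fun_biantiperiodic.
  - by case: WP => Wn Wr; split=> ? ?; rewrite ?Wn ?Wr mulNrn.
  rewrite -HS_mul_vec // defv Hv -defw.
  by apply: block_colP => i j; rewrite HS_vecE -HS_vecE !mxE.
have [|Z [ZP ZS VZ]] := lift_mod2 n_gt0 r_gt0 VP oddnr.
  (* The left side of [HS_fun_diff] is now a multiple of 4, so halving leaves [V a b - V a.+1 b.+1]
     even. *)
  by move=> a b; have /= := HS_fun_diff a b n_gt0 r_gt0 VP; rewrite !HV; lia.
exists (HS_vec n r (fun a b => ((V a b - Z a b) %/ 2)%Z)).
have HZ : HS n r *m HS_vec n r Z = 0.
  rewrite HS_mul_vec //; apply: block_colP => i j.
  by rewrite HS_vecE HS_fun_eq0 // !mxE.
set U := HS_vec n r (fun _ _ => _).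
have {}defv : v = HS_vec n r Z + U *+ 2.
  rewrite -defv; apply: block_colP => i j.
  have: submxcol U i j 0 = ((V i j - Z i j) %/ 2)%Z by rewrite HS_vecE.
  have := HS_vecE V i j; have := HS_vecE Z i j; have := VZ i j.
  by rewrite !mxE; lia.
(* As [HS n r] kills the lift [Z], doubling U gives the image of v, which is 4 w; a factor 2 cancels
   over the integers. *)
have: (HS n r *m U - w *+ 2) *+ 2 = 0.
  by rewrite mulrnBl -mulrnA -Hv defv mulmxDr HZ add0r mulmxMn subrr.
move=> /matrixP HUw; apply/matrixP => i j.
by have := HUw i j; rewrite !mxE; lia.
Qed.

Theorem proposition4p7 (n r : nat) (n_gt1 : (1 < n)%N) (n_le_r : (n <= r)%N)
    (HS_singular : \det (HS n r) = 0)
    (L : 'M[int]_(\sum_(i < n) r)) (h : seq int)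
    (Lh : block_diagonal_form (HS n r) L h) :
  {in h, forall x, `|x| != 4}.
Proof.
case: Lh => detL szh _ LHL x /(nthP 0)[m ltmh <-] {x}; apply/eqP => absh.
have n_gt0 : (0 < n)%N by exact: ltnW.
have r_gt0 : (0 < r)%N by exact: leq_trans n_le_r.
set N := (\sum_(i < n) r)%N in L detL szh LHL.
have lt1 : (m.*2.+1 < N)%N.
  by move: ltmh; rewrite szh; move: (corank _) => c; lia.
have lt0 : (m.*2 < N)%N by exact: ltnW.
pose i0 := Ordinal lt0; pose i1 := Ordinal lt1.
have uL : L \in unitmx by rewrite unitmxE; case: detL => ->.
have uLT : L^T \in unitmx by rewrite unitmx_tr.
have [s s_sign defh] : exists2 s : int, s = 1 \/ s = -1 & h`_m = s *+ 4.
  move: (h`_m) absh => x x4.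
  have [->|->] : x = 4 \/ x = -4 by lia.
    by exists 1; [left|].
  by exists (-1); [right|].
have D_i1 : skew_diag N h *m delta_mx i1 0 = h`_m *: (delta_mx i0 0 : 'cV_N).
  rewrite -colE; apply/colP => i; rewrite !mxE /= odd_double /= andbT.
  rewrite eqSS -val_eqE /= [m.*2 == _]eq_sym.
  case: eqP => [->|_]; last by rewrite andbF mulr0.
  by rewrite odd_double doubleK mulr1.
have D_i0 (z : 'cV_N) : (skew_diag N h *m z) i0 0 = h`_m * z i1 0.
  rewrite mxE (bigD1 i1) //= big1 => [|j].
    by rewrite mxE /= odd_double eqxx doubleK addr0.
  rewrite -val_eqE /= mxE /= odd_double /= => /negPf->.
  case: ifP => [/andP[even_j /eqP m2j]|_]; last by rewrite mul0r.
  by have := congr1 odd m2j; rewrite odd_double /= (negPf even_j).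
(* Column [i1] of the block form gives H L e_i1 = h (L^T)^-1 e_i0, which is 4 w for w = s (L^T)^-1
   e_i0. *)
have [|u Hu] := @HS_singular_halve n r (L *m delta_mx i1 0)
  (s *: (invmx L^T *m delta_mx i0 0)) n_gt0 r_gt0 HS_singular.
  apply: (can_inj (mulKmx uLT)); rewrite !mulmxA LHL D_i1 mulmxMn.
  by rewrite -scalemxAr mulKVmx // defh scalerMnl.
(* Coordinate [i0] of L^T H u = 2 s e_i0 reads 4 s z = 2 s for an integer z, which is impossible. *)
have := D_i0 (invmx L *m u).
rewrite -LHL -!mulmxA mulKVmx // Hu mulmxMn -scalemxAr mulKVmx //.
by rewrite !mxE !eqxx defh; case: s_sign => ->; lia.
Qed.
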